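(* Let $T$ be a bounded linear operator on a complex Banach space, and suppose that $T$ has rich point spectrum. If $\lambda\in\mathbb C$ is an extended eigenvalue for $T$, then $$\lambda\cdot\operatorname{int}\sigma_p(T)\subseteq\operatorname{clos}\sigma_p(T).$$
   Context: $\sigma_p(T)$ denotes the point spectrum (set of eigenvalues) of $T$; $\operatorname{int}$ and $\operatorname{clos}$ denote interior and closure in $\mathbb C$. A bounded linear operator $T$ on a complex Banach space $E$ has rich point spectrum if $\operatorname{int}\sigma_p(T)\neq\emptyset$ and for every (nonempty) open disc $D\subseteq\sigma_p(T)$ the family of eigenvectors $\bigcup_{z\in D}\ker(T-z)$ is a total set, i.e. its linear span is dense in $E$. A complex scalar $\lambda$ is an extended eigenvalue of $T$ if there is a nonzero bounded linear operator $X$ on $E$ with $TX=\lambda XT$. *)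

(* Defs.v *)
From HB Require Import structures.
From mathcomp Require Import all_boot all_order all_algebra.
From mathcomp Require Import all_classical all_reals all_analysis.
From mathcomp Require Export complex.

Set Implicit Arguments.
Unset Strict Implicit.
Unset Printing Implicit Defensive.

Import Order.TTheory GRing.Theory Num.Theory.
Import numFieldNormedType.Exports.

Local Open Scope classical_set_scope.
Local Open Scope ring_scope.

(* The scalar field is a general [K : numFieldType] because MathComp-Analysis
   attaches the norm topology to the structure [numFieldType], not to the bare
   carrier [R[i]]; complex scalars are the instance [K := R[i]].
   In [ball c r] with [c r : R[i]], [0 < r] forces [r] to be a positive real. *)

Section Operators.
Context {K : numFieldType} {E : normedModType K}.

Definition bounded_operator (T : {linear E -> E}) : Prop :=
  exists M : K, forall x : E, `|T x| <= M * `|x|.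

Lemma bounded_operatorP (T : {linear E -> E}) :
  bounded_operator T <-> bounded_near T (nbhs (0 : E)).
Proof.
split=> [[M TM]|/linear_boundedP TM].
- apply/bounded_funP => r; exists (`|M| * `|r|) => x xr.
  apply: le_trans (TM x) _.
  have Mx : M * `|x| \is Num.real.
    by have := le_trans (normr_ge0 _) (TM x); exact: ger0_real.
  apply: le_trans (real_ler_norm Mx) _.
  rewrite normrM normr_id ler_wpM2l//.
  apply: le_trans (xr) _; apply: real_ler_norm; apply: ger0_real.
  exact: le_trans (normr_ge0 x) xr.
- by have [M _ MT] := pinfty_ex_gt0 TM; exists M.
Qed.

Definition op_eigenspace (T : {linear E -> E}) (z : K) : set E :=
  [set x | T x - z *: x = 0].

Definition point_spectrum (T : {linear E -> E}) : set K :=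
  [set z | exists2 x : E, x != 0 & op_eigenspace T z x].

Definition linear_span (A : set E) : set E :=
  [set x | exists (n : nat) (a : 'I_n -> K) (v : 'I_n -> E),
    (forall i, A (v i)) /\ x = \sum_(i < n) a i *: v i].

Definition total_family (A : set E) : Prop := dense (linear_span A).

Definition rich_point_spectrum (T : {linear E -> E}) : Prop :=
  interior (point_spectrum T) !=set0 /\
  forall c r : K, 0 < r -> ball c r `<=` point_spectrum T ->
    total_family (\bigcup_(z in ball c r) op_eigenspace T z).

Definition extended_eigenvalue (T : {linear E -> E}) (lambda : K) : Prop :=
  exists X : {linear E -> E},
    [/\ bounded_operator X,
        exists x, X x != 0
      & forall x, T (X x) = lambda *: X (T x)].

End Operators.

(* Main.v *)
(* If x is an eigenvector of T at w and T X = lambda X T, then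
   T (X x) = (lambda w) X x, so X x = 0 unless lambda w is an eigenvalue.
   Were a whole disc around z multiplied by lambda off the point spectrum,
   X would vanish on a total set, hence everywhere. *)
Require Import Defs.
From mathcomp Require Import all_boot all_order all_algebra.
From mathcomp Require Import all_classical all_reals all_analysis.
Import Order.TTheory GRing.Theory Num.Theory.
Import numFieldNormedType.Exports.
Local Open Scope classical_set_scope.
Local Open Scope ring_scope.
Local Open Scope complex_scope.

Lemma bounded_operator_continuous (K : numFieldType) (E : normedModType K)
    (X : {linear E -> E}) : bounded_operator X -> continuous X.
Proof.
by move=> /bounded_operatorP X0; apply/linear_bounded_continuous.
Qed.

(** By continuity the set where [X] is nonzero is open; were it nonempty, density would put a point
    of the span of [A] in it, yet [X] vanishes there by linearity. *)
Lemma bounded_operator_total_eq0 (K : numFieldType) (E : normedModType K)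
    (X : {linear E -> E}) (A : set E) :
  bounded_operator X -> total_family A -> (forall x, A x -> X x = 0) ->
  forall x, X x = 0.
Proof.
move=> /bounded_operator_continuous Xc Ad XA x; apply: contrapT => Xx.
have oX : open (X @^-1` (~` [set 0])).
  apply: open_comp => [y _|]; first exact: Xc.
  by rewrite openC; apply: accessible_closed_set1; apply: hausdorff_accessible.
have [|y [Xy [n [a [v [Av y_def]]]]]] := Ad _ _ oX; first by exists x.
apply: Xy; rewrite y_def linear_sum big1 // => i _.
by rewrite linearZ /= (XA _ (Av i)) scaler0.
Qed.

Lemma intertwiner_eigenspace (K : numFieldType) (E : normedModType K)
    (T X : {linear E -> E}) (lambda w : K) (x : E) :
  (forall y, T (X y) = lambda *: X (T y)) ->
  op_eigenspace T w x -> op_eigenspace T (lambda * w) (X x).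
Proof.
move=> TX /subr0_eq Tx; rewrite /op_eigenspace /= TX Tx linearZ /= scalerA.
exact: subrr.
Qed.

Theorem theorem3p1 (R : realType) (E : completeNormedModType R[i])
    (T : {linear E -> E}) (hT : bounded_operator T)
    (hrich : rich_point_spectrum T)
    (lambda : R[i]) (hlambda : extended_eigenvalue T lambda) :
  [set lambda * z | z in interior (point_spectrum T)]
    `<=` closure (point_spectrum T).
Proof.
move=> _ [z zT <-] B Bz.
have Bl : nbhs z [set w | B (lambda * w)] by exact: mulrl_continuous Bz.
(* A single disc does two jobs: it lies in the point spectrum, so richness applies to it, and
   multiplication by [lambda] sends it into [B]. *)
have /nbhs_ballP[r r0 rP] : nbhs z (point_spectrum T `&` [set w | B (lambda * w)]).
  exact: filterI.
case: hlambda => X [Xb [x Xx] TX]; apply: contrapT => noB.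
move/eqP: Xx; apply; move: x.
apply: (bounded_operator_total_eq0 _ _ _ _ Xb (hrich.2 z r r0 _)).
  by move=> w /rP[].
(* A nonzero [X y] would be an eigenvector at [lambda * w], a point of [B], against [noB]. *)
move=> y [w /rP[_ Bw] Ty]; apply: contrapT => /eqP Xy.
apply: noB; exists (lambda * w); split => //.
by exists (X y) => //; exact: intertwiner_eigenspace Ty.
Qed.
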